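(* Let $G$ be a graph with $n$ vertices $v_1,\dots,v_n$, where $v_i$ has degree $d_i$, and let $L$ be a list assignment on $G$ in which the list $L(v_i)$ has size $k_i$ (the lists may have different sizes). Suppose that $G$ has exactly one proper $L$-list coloring $c$, and that the average degree of $G$ equals $\frac{\sum_{i=1}^{n}2(k_i-1)}{n}$. For each color $t\in\bigcup_{i=1}^n L(v_i)$, let $V(t)$ be the set of vertices $v$ with $c(v)=t$, let $\widetilde V(t)=V(G)\setminus V(t)$, let $b_t$ be the number of vertices in $\widetilde V(t)$ that have at least one neighbor in $V(t)$ and whose list contains $t$, and let $d_t$ be the number of edges of $G$ between $V(t)$ and $\widetilde V(t)$. Then for each color $t\in\bigcup_{i=1}^n L(v_i)$, $$\sum_{v_i\in V(t)}\bigl(d_i-2(k_i-1)\bigr)=2b_t-d_t.$$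
   Context: Graphs are finite and simple. A list assignment $L$ assigns to each vertex $v$ a finite set $L(v)$ of colors. A proper $L$-list coloring of $G$ is a map $c$ on $V(G)$ with $c(v)\in L(v)$ for all $v\in V(G)$ and $c(u)\ne c(v)$ for every edge $uv\in E(G)$. *)

(* Defs.v *)
(* MathComp world. *)
From mathcomp Require Import all_boot all_order all_algebra.
From mathcomp Require Import finmap.

Set Implicit Arguments.
Unset Strict Implicit.
Unset Printing Implicit Defensive.

Import GRing.Theory Num.Theory.

Local Open Scope ring_scope.

(* A finite simple graph is a symmetric irreflexive relation e on a finType. *)

Definition neighbors (T : finType) (e : rel T) (v : T) : {set T} :=
  [set u | e v u].

Definition degree (T : finType) (e : rel T) (v : T) : nat :=
  #|neighbors e v|.

Definition avg_degree (T : finType) (e : rel T) : rat :=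
  (\sum_(v : T) (degree e v)%:Q) / #|T|%:Q.

(* Edges are unordered pairs, so that each one is counted once. *)
Definition edges (T : finType) (e : rel T) : {set {set T}} :=
  [set [set p.1; p.2] | p : T * T & e p.1 p.2].

Definition edges_between (T : finType) (e : rel T) (A B : {set T}) :
    {set {set T}} :=
  [set f in edges e | [exists u in A, exists v in B, f == [set u; v]]].

Definition proper_list_coloring (T : finType) (e : rel T) (C : choiceType)
    (L : T -> {fset C}) (c : {ffun T -> C}) : Prop :=
  (forall v, c v \in L v) /\ (forall u v, e u v -> c u != c v).

Definition color_class (T : finType) (C : choiceType) (c : {ffun T -> C})
    (t : C) : {set T} :=
  [set v | c v == t].

Definition b_ (T : finType) (e : rel T) (C : choiceType) (L : T -> {fset C})
    (c : {ffun T -> C}) (t : C) : nat :=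
  #|[set v in ~: color_class c t |
       [exists u in color_class c t, e v u] && (t \in L v)]|.

Definition d_ (T : finType) (e : rel T) (C : choiceType) (c : {ffun T -> C})
    (t : C) : nat :=
  #|edges_between e (color_class c t) (~: color_class c t)|.

(* Main.v *)
(* Write K = sum (k_v - 1).  Deleting a set S of vertices coloured t, and t from
   the lists of the neighbours of S, keeps the coloring unique.  Hence, if
   K <= |E| holds for the smaller graph, then
     K + deg S <= |E| + sum_(S) (k_v - 1) + b_S.
   By uniqueness every spare color of v is the color of a neighbour of v, so that
   summing over the color classes gives sum_t b_t = K and sum_t deg V(t) = 2 |E|.
   This yields K <= |E| by induction on the number of vertices: with at least
   three colors, average over the color classes; if some list is a singleton,
   delete its vertex; otherwise every list consists of the same two colors, and
   swapping them contradicts uniqueness.  If K = |E|, the inequality reads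
   deg V(t) <= sum_(V(t)) (k_v - 1) + b_t for each t, and it is an equality after
   summation over t, hence for every t; finally deg V(t) = d_t. *)

Require Import Defs.
From mathcomp Require Import all_boot all_order all_algebra.
From mathcomp Require Import finmap zify.

Set Implicit Arguments.
Unset Strict Implicit.
Unset Printing Implicit Defensive.

Import GRing.Theory Num.Theory.

Local Open Scope ring_scope.

(** * List colorings on a vertex set, and the quantities counted on it *)

Definition coloring_on (T : finType) (e : rel T) (C : choiceType)
    (L : T -> {fset C}) (A : {set T}) (c : T -> C) : Prop :=
  {in A, forall v, c v \in L v} /\ {in A &, forall u v, e u v -> c u != c v}.

(** Deletion shrinks [A] and keeps the vertex type, so colorings are total functions compared on [A]
    only. *)
Definition unique_on (T : finType) (e : rel T) (C : choiceType)
    (L : T -> {fset C}) (A : {set T}) (c : T -> C) : Prop :=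
  coloring_on e L A c /\ forall c', coloring_on e L A c' -> {in A, c' =1 c}.

Definition strike (T : finType) (e : rel T) (C : choiceType)
    (L : T -> {fset C}) (S : {set T}) (t : C) (v : T) : {fset C} :=
  if [exists u in S, e v u] then (L v `\ t)%fset else L v.

(* The sum of the k_v - 1 when [c v \in L v]. *)
Definition excess (T : finType) (C : choiceType)
    (L : T -> {fset C}) (c : T -> C) (A : {set T}) : nat :=
  \sum_(v in A) #|` (L v `\ c v)%fset|.

(* Ordered pairs are counted, so [arcs e A A] is twice the number of edges in A. *)
Definition arcs (T : finType) (e : rel T) (A B : {set T}) : nat :=
  \sum_(v in A) \sum_(u in B) e v u.

Definition struck (T : finType) (e : rel T) (C : choiceType)
    (L : T -> {fset C}) (A S : {set T}) (t : C) : nat :=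
  \sum_(v in A :\: S) ([exists u in S, e v u] && (t \in L v)).

(** * Deleting a monochromatic vertex set *)

(** Any coloring of [A :\: S] from the struck lists extends by [t] on [S]: the neighbors of [S] can
    no longer use [t], and [S] is independent because [c] is constant on it. *)
Lemma unique_on_delete (T : finType) (e : rel T) (C : choiceType)
    (L : T -> {fset C}) (A S : {set T}) (c : T -> C) (t : C) :
  symmetric e -> unique_on e L A c -> S \subset A -> {in S, forall v, c v = t} ->
  unique_on e (strike e L S t) (A :\: S) c.
Proof.
move=> e_sym [[cL cE] cU] /subsetP sSA cS; split.
  split=> [v | u v]; last first.
    by move=> /setDP[uA _] /setDP[vA _]; apply: cE.
  case/setDP=> vA _; rewrite /strike; case: ifP => [/exists_inP[u uS evu]|_].
    by rewrite in_fsetD1 cL // andbT -(cS u uS) cE // sSA.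
  exact: cL.
move=> c' [c'L c'E] v /setDP[vA vS].
pose g v := if v \in S then t else c' v.
have c't w u : w \in A -> w \notin S -> u \in S -> e w u -> c' w != t.
  move=> wA wS uS ewu; have := c'L w; rewrite inE wA wS => /(_ isT).
  rewrite /strike ifT; first by rewrite in_fsetD1 => /andP[].
  by apply/exists_inP; exists u.
suff /cU/(_ v vA) : coloring_on e L A g by rewrite /g (negPf vS).
split=> [w wA | u w uA wA euw]; rewrite /g.
  case: ifPn => wS; first by rewrite -(cS w wS) cL.
  have := c'L w; rewrite inE wA wS => /(_ isT); rewrite /strike.
  by case: ifP => // _; rewrite in_fsetD1 => /andP[].
case: ifPn => uS; case: ifPn => wS.
- by have := cE u w uA wA euw; rewrite !cS ?eqxx.
- by rewrite eq_sym; apply: (c't w u); rewrite // e_sym.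
- exact: (c't u w).
- by apply: c'E; rewrite // inE ?uS ?wS.
Qed.

(** Otherwise recoloring [v] alone with [t] would give a second coloring. *)
Lemma unique_on_neighbor (T : finType) (e : rel T) (C : choiceType)
    (L : T -> {fset C}) (A : {set T}) (c : T -> C) (v : T) (t : C) :
  symmetric e -> irreflexive e -> unique_on e L A c ->
  v \in A -> t \in L v -> t != c v -> exists2 u, u \in A & e v u && (c u == t).
Proof.
move=> e_sym e_irr [[cL cE] cU] vA tL tc; apply/exists_inP.
apply: contraNT tc => /exists_inPn noN.
pose g w := if w == v then t else c w.
suff /cU/(_ v vA) : coloring_on e L A g by rewrite /g eqxx => ->.
split=> [w wA | u w uA wA euw]; rewrite /g.
  by case: (eqVneq w v) => [->|_] //; apply: cL.
case: (eqVneq u v) => [uv|_]; case: (eqVneq w v) => [wv|_].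
- by rewrite uv wv e_irr in euw.
- by have := noN w wA; rewrite -uv euw eq_sym.
- by have := noN u uA; rewrite e_sym -wv euw.
- exact: cE.
Qed.

Lemma excess_setD (T : finType) (C : choiceType) (L : T -> {fset C})
    (c : T -> C) (A S : {set T}) :
  S \subset A -> excess L c A = (excess L c (A :\: S) + excess L c S)%N.
Proof.
by move=> sSA; rewrite /excess (big_setID S) /= (setIidPr sSA) addnC.
Qed.

(** A neighbor of [S] does not have color [t] itself, so striking [t] removes a spare color. *)
Lemma excess_strike (T : finType) (e : rel T) (C : choiceType)
    (L : T -> {fset C}) (A S : {set T}) (c : T -> C) (t : C) :
  coloring_on e L A c -> S \subset A -> {in S, forall v, c v = t} ->
  excess L c (A :\: S) = (excess (strike e L S t) c (A :\: S) + struck e L A S t)%N.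
Proof.
move=> [cL cE] /subsetP sSA cS; rewrite /excess /struck -big_split /=.
apply: eq_bigr => v /setDP[vA vS]; rewrite /strike.
case: ifP => [/exists_inP[u uS evu]|_]; last by rewrite addn0.
have tc : t != c v by rewrite -(cS u uS) eq_sym cE // sSA.
rewrite (cardfsD1 t) in_fsetD1 tc /= addnC; congr (_ + _)%N.
by rewrite fsetDDl fsetUC -fsetDDl.
Qed.

Lemma arcs_sym (T : finType) (e : rel T) (A B : {set T}) :
  symmetric e -> arcs e A B = arcs e B A.
Proof.
move=> e_sym; rewrite /arcs exchange_big /=.
by apply: eq_bigr => v _; apply: eq_bigr => u _; rewrite e_sym.
Qed.

Lemma arcs_setDl (T : finType) (e : rel T) (A S B : {set T}) :
  S \subset A -> arcs e A B = (arcs e (A :\: S) B + arcs e S B)%N.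
Proof.
by move=> sSA; rewrite /arcs (big_setID S) /= (setIidPr sSA) addnC.
Qed.

Lemma arcs_monochromatic (T : finType) (e : rel T) (C : choiceType)
    (L : T -> {fset C}) (A S : {set T}) (c : T -> C) (t : C) :
  symmetric e -> coloring_on e L A c -> S \subset A -> {in S, forall v, c v = t} ->
  arcs e S A = arcs e S (A :\: S).
Proof.
move=> e_sym [_ cE] sSA cS; rewrite arcs_sym // (arcs_setDl _ _ sSA) arcs_sym //.
rewrite -[RHS]addn0; congr (_ + _)%N.
apply: big1 => v vS; apply: big1 => u uS; apply/eqP; rewrite eqb0.
apply/negP=> /cE; rewrite !cS // eqxx => /(_ _ _)/negP.
by case=> //; apply: (subsetP sSA).
Qed.

(** As [S] is independent, only pairs between [S] and the rest of [A] are lost, each in both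
    orders. *)
Lemma arcs_delete (T : finType) (e : rel T) (C : choiceType)
    (L : T -> {fset C}) (A S : {set T}) (c : T -> C) (t : C) :
  symmetric e -> coloring_on e L A c -> S \subset A -> {in S, forall v, c v = t} ->
  arcs e A A = (arcs e (A :\: S) (A :\: S) + 2 * arcs e S A)%N.
Proof.
move=> e_sym cA sSA cS; have eSA := arcs_monochromatic e_sym cA sSA cS.
rewrite (arcs_setDl _ _ sSA) [arcs _ (A :\: S) A]arcs_sym //.
rewrite (arcs_setDl _ _ sSA) -eSA; lia.
Qed.

Lemma delete_ineq (T : finType) (e : rel T) (C : choiceType)
    (L : T -> {fset C}) (A S : {set T}) (c : T -> C) (t : C) :
  symmetric e -> coloring_on e L A c -> S \subset A -> {in S, forall v, c v = t} ->
  (2 * excess (strike e L S t) c (A :\: S) <= arcs e (A :\: S) (A :\: S))%N ->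
  (2 * excess L c A + 2 * arcs e S A <=
     arcs e A A + 2 * excess L c S + 2 * struck e L A S t)%N.
Proof.
move=> e_sym cA sSA cS.
rewrite (excess_setD _ _ sSA) (excess_strike cA sSA cS).
rewrite (arcs_delete e_sym cA sSA cS).
lia.
Qed.

(** * Summation over the color classes *)

Definition class_on (T : finType) (C : choiceType) (A : {set T}) (c : T -> C)
    (t : C) : {set T} := [set v in A | c v == t].

Definition colors_on (T : finType) (C : choiceType) (A : {set T}) (c : T -> C) :
  {fset C} := [fset c v | v in A]%fset.

Lemma sum_class_on (T : finType) (C : choiceType) (A : {set T}) (c : T -> C)
    (F : T -> nat) :
  (\sum_(t <- colors_on A c) \sum_(v in class_on A c t) F v = \sum_(v in A) F v)%N.
Proof.
under eq_bigr => t _ do under eq_bigl => v do rewrite inE.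
rewrite (exchange_big_dep (mem A)) /=; last by move=> t v _ /andP[].
apply: eq_bigr => v vA; under eq_bigl => t do rewrite vA eq_sym.
rewrite -big_filter filter_pred1_uniq ?fset_uniq ?big_seq1 //.
by apply/imfsetP; exists v.
Qed.

Lemma sub_colors_on (T : finType) (e : rel T) (C : choiceType)
    (L : T -> {fset C}) (A : {set T}) (c : T -> C) (v : T) :
  symmetric e -> irreflexive e -> unique_on e L A c -> v \in A ->
  (L v `<=` colors_on A c)%fset.
Proof.
move=> e_sym e_irr cU vA; apply/fsubsetP=> t tL; apply/imfsetP.
have [->|tc] := eqVneq t (c v); first by exists v.
have [u uA /andP[_ /eqP <-]] := unique_on_neighbor e_sym e_irr cU vA tL tc.
by exists u.
Qed.

Lemma sum_struck (T : finType) (e : rel T) (C : choiceType)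
    (L : T -> {fset C}) (A : {set T}) (c : T -> C) :
  symmetric e -> irreflexive e -> unique_on e L A c ->
  (\sum_(t <- colors_on A c) struck e L A (class_on A c t) t = excess L c A)%N.
Proof.
move=> e_sym e_irr cU.
rewrite /struck (exchange_big_dep (mem A)) /=; last by move=> t v _ /setDP[].
apply: eq_bigr => v vA.
(* By [unique_on_neighbor], [v] is struck for exactly its spare colors. *)
transitivity (\sum_(t <- colors_on A c | t \in (L v `\ c v)%fset) 1)%N.
  rewrite big_mkcond [RHS]big_mkcond; apply: eq_bigr => t _.
  rewrite !inE vA andbT /= eq_sym; case: eqVneq => //= tc.
  case tL: (t \in L v); last by rewrite andbF.
  have [u uA /andP[evu cu]] := unique_on_neighbor e_sym e_irr cU vA tL tc.
  rewrite andbT (_ : [exists u in _, _]) //; apply/exists_inP.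
  by exists u => //; rewrite inE uA.
rewrite sum1_count -size_filter; apply/perm_size/uniq_perm.
- by rewrite filter_uniq ?fset_uniq.
- exact: fset_uniq.
move=> t; rewrite mem_filter andb_idr // in_fsetD1 => /andP[_].
exact/fsubsetP/(sub_colors_on e_sym e_irr cU vA).
Qed.

(** * The inequality between excess and edges, and its equality case *)

Lemma excess_le_arcs (T : finType) (e : rel T) (C : choiceType)
    (L : T -> {fset C}) (A : {set T}) (c : T -> C) :
  symmetric e -> irreflexive e -> unique_on e L A c ->
  (2 * excess L c A <= arcs e A A)%N.
Proof.
(* [L] is generalized along with [A], since deletion also shortens lists. *)
move=> e_sym e_irr; have [n] := ubnP #|A|; elim: n A L => // n IHn A L An cU.
have step (S : {set T}) t : S \subset A -> S != set0 -> {in S, forall v, c v = t} ->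
  (2 * excess L c A + 2 * arcs e S A <=
     arcs e A A + 2 * excess L c S + 2 * struck e L A S t)%N.
  move=> sSA S0 cS; apply: (delete_ineq e_sym (proj1 cU) sSA cS).
  apply: IHn; last exact: unique_on_delete.
  move: An; rewrite ltnS; apply: leq_trans.
  rewrite -(cardsID S A) (setIidPr sSA) -[X in (X < _)%N]add0n ltn_add2r.
  by rewrite card_gt0.
have [/exists_inP[v vA /eqP kv0]|/exists_inPn kv] :=
    boolP [exists v in A, #|` (L v `\ c v)%fset| == 0%N].
  have cv : {in [set v], forall u, c u = c v} by move=> u /set1P->.
  have vA1 : [set v] \subset A by rewrite sub1set.
  have v0 : [set v] != set0 by rewrite -card_gt0 cards1.
  have := step [set v] (c v) vA1 v0 cv.
  rewrite {2}/excess big_set1 kv0 {1}/arcs big_set1.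
  (* As [v] has no spare color, it is enough that the struck vertices are among its neighbors. *)
  suff : (struck e L A [set v] (c v) <= \sum_(u in A) e v u)%N by lia.
  rewrite /struck big_mkcond [leqRHS]big_mkcond /=; apply: leq_sum => u _.
  rewrite inE; case: (u \in A); last by rewrite andbF.
  case: (_ \notin _) => //=; case: exists_inP => //= -[w /set1P->].
  by rewrite e_sym => ->; case: (_ \in _).
have [->|[v0 v0A]] := set_0Vmem A; first by rewrite /excess big_set0.
set s := colors_on A c.
have cs v : v \in A -> c v \in s by move=> vA; apply/imfsetP; exists v.
have [s3|s2] := leqP 3 #|` s|.
  have H t : t \in (s : seq C) ->
    (2 * excess L c A + 2 * arcs e (class_on A c t) A <=
     arcs e A A + 2 * excess L c (class_on A c t) +
     2 * struck e L A (class_on A c t) t)%N.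
    move=> /imfsetP[u /= uA ->]; apply: step.
    - by apply/subsetP=> w; rewrite inE => /andP[].
    - by apply/set0Pn; exists u; rewrite inE uA eqxx.
    - by move=> w; rewrite inE => /andP[_ /eqP].
  have : (\sum_(t <- s) (2 * excess L c A + 2 * arcs e (class_on A c t) A) <=
     \sum_(t <- s) (arcs e A A + 2 * excess L c (class_on A c t) +
     2 * struck e L A (class_on A c t) t))%N.
    by rewrite big_seq [leqRHS]big_seq; apply: leq_sum.
  rewrite !big_split /= sum_struck // !sum_class_on.
  rewrite -/(excess _ _ _) -/(arcs _ _ _) !big_const_seq !iter_addn !count_predT.
  (* With [m] colors the sum says that [m - 2] times twice the excess is at most [m - 2] times
     [arcs e A A]; three colors make this factor positive. *)
  move: s3; rewrite /=; move: (size _) => m.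
  case: m => [|[|[|m]]] // _; nia.
(* All lists are the same two colors, and [g] is the swap of these colors. *)
pose g v := head (c v) (L v `\ c v)%fset.
(* By [kv] a spare color exists, so the default of [head] is never taken on [A]. *)
have gP v : v \in A -> g v \in (L v `\ c v)%fset.
  move/kv; rewrite -[g v \in _]/(g v \in enum_fset _) /g.
  by case: (enum_fset _) => //= t l _; rewrite mem_head.
have gc v : v \in A -> g v != c v by move/gP; rewrite in_fsetD1 => /andP[].
have gL v : v \in A -> g v \in L v by move/gP; rewrite in_fsetD1 => /andP[].
suff /(proj2 cU)/(_ v0 v0A) /eqP : coloring_on e L A g by rewrite (negPf (gc _ v0A)).
(* If [g] agreed on an edge [u w], then [c u], [c w] and [g u] would be three distinct colors. *)
split=> // u w uA wA euw; apply: contraTneq s2 => guw; rewrite -leqNgt.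
apply: (@uniq_leq_size _ [:: c u; c w; g u]).
  rewrite /= !inE negb_or (proj2 (proj1 cU)) //= eq_sym gc //= guw eq_sym gc //.
move=> t; rewrite !inE => /or3P[] /eqP->; rewrite ?cs //.
exact: (fsubsetP (sub_colors_on e_sym e_irr cU uA)) (gL u uA).
Qed.

Lemma arcs_class_tight (T : finType) (e : rel T) (C : choiceType)
    (L : T -> {fset C}) (A : {set T}) (c : T -> C) (t : C) :
  symmetric e -> irreflexive e -> unique_on e L A c ->
  arcs e A A = (2 * excess L c A)%N -> t \in colors_on A c ->
  arcs e (class_on A c t) A =
    (excess L c (class_on A c t) + struck e L A (class_on A c t) t)%N.
Proof.
move=> e_sym e_irr cU eA ts.
have le r : (arcs e (class_on A c r) A <=
    excess L c (class_on A c r) + struck e L A (class_on A c r) r)%N.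
  have sSA : class_on A c r \subset A by apply/subsetP=> w; rewrite inE => /andP[].
  have cS : {in class_on A c r, forall v, c v = r}.
    by move=> w; rewrite inE => /andP[_ /eqP].
  have := delete_ineq e_sym (proj1 cU) sSA cS
    (excess_le_arcs e_sym e_irr (unique_on_delete e_sym cU sSA cS)).
  lia.
(* Both sums equal twice the excess, so no termwise inequality [le r] can be strict. *)
have : (\sum_(r <- colors_on A c) arcs e (class_on A c r) A =
  \sum_(r <- colors_on A c)
    (excess L c (class_on A c r) + struck e L A (class_on A c r) r))%N.
  rewrite big_split /= sum_struck // !sum_class_on.
  by rewrite -/(excess _ _ _) -/(arcs _ _ _) eA mul2n addnn.
rewrite !(big_rem t ts) /=.
have : (\sum_(r <- rem t (colors_on A c)) arcs e (class_on A c r) A <=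
  \sum_(r <- rem t (colors_on A c))
    (excess L c (class_on A c r) + struck e L A (class_on A c r) r))%N.
  by apply: leq_sum => r _.
set X := (\sum_(r <- _) arcs _ _ _)%N; set Y := (\sum_(r <- _) (_ + _))%N.
by move: X Y (le t) => X Y; lia.
Qed.

(** * The numbers [d_ e c t] and [b_ e L c t] as counts on the whole graph *)

(** The color tells the two ends of such an edge apart, so each edge comes from one ordered pair
    only. *)
Lemma d_arcs (T : finType) (e : rel T) (C : choiceType) (c : {ffun T -> C}) (t : C) :
  symmetric e -> d_ e c t = arcs e (color_class c t) (~: color_class c t).
Proof.
move=> e_sym; set S := color_class c t.
pose P := [set p : T * T | [&& p.1 \in S, p.2 \in ~: S & e p.1 p.2]].
have -> : d_ e c t = #|[set [set p.1; p.2] | p in P]|.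
  congr #|pred_of_set _|; apply/setP=> f; rewrite inE; apply/andP/imsetP.
    move=> [/imsetP[[x y] /=]]; rewrite inE /= => exy ->.
    case/exists_inP=> u uS /exists_inP[v vS /eqP E].
    have uv : u != v by apply: contraTneq uS => ->; rewrite inE in vS.
    exists (u, v) => //; rewrite inE /= uS vS /=.
    have : u \in [set x; y] by rewrite E set21.
    have : v \in [set x; y] by rewrite E set22.
    rewrite !inE => /orP[]/eqP vE /orP[]/eqP uE.
    - by rewrite uE vE eqxx in uv.
    - by rewrite uE vE e_sym.
    - by rewrite uE vE.
    - by rewrite uE vE eqxx in uv.
  case=> [[u v]]; rewrite inE /= => /and3P[uS vS euv ->]; split.
    by apply/imsetP; exists (u, v); rewrite ?inE.
  by apply/exists_inP; exists u => //; apply/exists_inP; exists v.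
rewrite card_in_imset; last first.
  move=> [u v] [u' v']; rewrite !inE /=.
  have neq x y : c x == t -> c y != t -> x != y by move=> xt; apply: contraNneq => <-.
  move=> /and3P[uS vS _] /and3P[u'S v'S _] E.
  have : u \in [set u'; v'] by rewrite -E set21.
  have : v \in [set u'; v'] by rewrite -E set22.
  rewrite !inE (negPf (neq _ _ uS v'S)) [v == u']eq_sym (negPf (neq _ _ u'S vS)).
  by rewrite orbF => /eqP-> /eqP->.
rewrite /arcs pair_big_dep /= -sum1_card [LHS]big_mkcond [RHS]big_mkcond /=.
apply: eq_bigr => -[u v] _; rewrite inE /= .
by case: (u \in S); case: (v \in ~: S); case: (e u v).
Qed.

Lemma b_struck (T : finType) (e : rel T) (C : choiceType) (L : T -> {fset C})
    (c : {ffun T -> C}) (t : C) :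
  b_ e L c t = struck e L setT (color_class c t) t.
Proof.
rewrite /b_ /struck -sum1_card big_mkcond [RHS]big_mkcond /=.
apply: eq_bigr => v _; rewrite !inE andbT.
by case: (c v != t) => //=; case: (_ && _).
Qed.


Theorem theorem7 (T : finType) (e : rel T)
    (e_sym : symmetric e) (e_irrefl : irreflexive e)
    (C : choiceType) (L : T -> {fset C}) (c : {ffun T -> C})
    (c_proper : proper_list_coloring e L c)
    (c_unique : forall c' : {ffun T -> C}, proper_list_coloring e L c' -> c' = c)
    (h_avg : avg_degree e =
             (\sum_(v : T) 2%:Q * ((#|` L v|)%:Q - 1)) / #|T|%:Q) :
  forall t : C, t \in (\bigcup_(v <- enum T) L v)%fset ->
    \sum_(v in color_class c t)
       ((degree e v)%:Z - 2%:Z * ((#|` L v|)%:Z - 1))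
    = 2%:Z * (b_ e L c t)%:Z - (d_ e c t)%:Z.
Proof.
move=> t /bigfcupP[v0 _ tL].
have [cL cE] := c_proper.
have cU : unique_on e L setT c.
  split; first by split=> [v _|u v _ _]; [exact: cL | exact: cE].
  move=> c' [c'L c'E] v _; rewrite -(c_unique (finfun c')) ?ffunE //.
  split=> [u|u w euw]; rewrite !ffunE; first exact: c'L.
  exact: c'E.
have degE v : degree e v = (\sum_(u in [set: T]) e v u)%N.
  rewrite /degree -sum1_card big_mkcond [RHS]big_mkcond /=.
  by apply: eq_bigr => u _; rewrite !inE; case: (e v u).
have LE v : (#|` L v|)%:Z - 1 = #|` (L v `\ c v)%fset|%:Z.
  by rewrite (cardfsD1 (c v)) cL; lia.
have eT : arcs e setT setT = (2 * excess L c setT)%N.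
  (* The vertex [v0], whose list contains [t], makes the common denominator in [h_avg] nonzero. *)
  have T0 : #|T|%:Q != 0.
    by rewrite intr_eq0; apply/eqP=> -[] /card0_eq/(_ v0).
  move: h_avg => /(divIf T0).
  under eq_bigr do rewrite degE.
  under [RHS]eq_bigr do rewrite -[1]/(1%:~R) -intrB LE -intrM.
  rewrite -!rmorph_sum /= => /intr_inj.
  case=> E.
  rewrite /arcs /excess (eq_bigl predT) => [|v]; last by rewrite inE.
  by rewrite E big_distrr /=; apply: eq_bigl => v; rewrite inE.
(* By uniqueness every list color is used by [c]. *)
have tc : t \in colors_on setT c.
  exact: (fsubsetP (sub_colors_on e_sym e_irrefl cU (in_setT v0))).
have := arcs_class_tight e_sym e_irrefl cU eT tc.
have -> : class_on setT c t = color_class c t by apply/setP=> v; rewrite !inE.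
rewrite -b_struck.
have dE : arcs e (color_class c t) setT = d_ e c t.
  rewrite d_arcs // -setTD; apply: (arcs_monochromatic (t := t) e_sym (proj1 cU)) => //.
  by move=> v; rewrite inE => /eqP.
rewrite dE => dbE.
(* With [x] the excess of the class, the left side becomes [d - 2 * x], and [dbE] gives
   [x = d - b]. *)
rewrite big_split /= sumrN -big_distrr /=.
under eq_bigr do rewrite degE.
under [X in _ - _ * X]eq_bigr do rewrite LE.
rewrite -!(big_morph Posz PoszD (erefl _)).
rewrite -/(arcs _ _ _) -/(excess _ _ _) dE dbE.
lia.
Qed.
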